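(* The configuration value $CV$ is the unique configurational Shapley value satisfying additivity in representatives (ADD-R), balanced contributions for coalition configurations (BC-CC) and the coalitional-quotient game property (CQ). That is, $CV$ is a configurational Shapley value satisfying (ADD-R), (BC-CC) and (CQ), and any configurational Shapley value $\psi$ satisfying (ADD-R), (BC-CC) and (CQ) satisfies $\psi(N,c,\mathcal{B})=CV(N,c,\mathcal{B})$ for every game with coalition configuration $(N,c,\mathcal{B})$.
   Context: A cost game is a pair $(N,c)$ with $N$ a finite set of players and $c:2^N\to\mathbb{R}$, $c(\emptyset)=0$. A coalition configuration of $N$ is a family $\mathcal{B}=\{B_1,\dots,B_m\}$ of (nonempty, not necessarily disjoint) subsets of $N$, indexed by $1,\dots,m$, with $\bigcup_{r=1}^m B_r=N$. For $i\in N$, $\mathcal{B}^i=\{B_p\in\mathcal{B} : i\in B_p\}$. The triple $(N,c,\mathcal{B})$ is called a game with coalition configuration; it is a game with a priori unions when $\mathcal{B}$ is a partition of $N$. An allocation rule $\psi$ assigns to every game with coalition configuration $(N,c,\mathcal{B})$ (over all finite player sets) a vector $\psi(N,c,\mathcal{B})\in\mathbb{R}^{N}$. The configuration value is the allocation rule $$CV_i(N,c,\mathcal{B})=\sum_{B_q\in\mathcal{B}^i}\ \sum_{\substack{\mathcal{C}\subseteq\mathcal{B}\\ \mathcal{C}\cap\mathcal{B}^i=\emptyset}}\ \sum_{\substack{S\subseteq B_q\\ i\in S}}\frac{|\mathcal{C}|!\,(m-|\mathcal{C}|-1)!}{m!}\,\frac{(|S|-1)!\,(|B_q|-|S|)!}{|B_q|!}\Big(c(A_{\mathcal{C}}\cup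 S)-c\big(A_{\mathcal{C}}\cup(S\setminus\{i\})\big)\Big),$$ where $A_{\mathcal{C}}=\bigcup_{B_r\in\mathcal{C}}B_r$. A configurational Shapley value is an allocation rule $\psi$ such that, whenever $\mathcal{B}$ is the trivial coalition configuration $\{\{i\}: i\in N\}$, $\psi(N,c,\mathcal{B})$ is the Shapley value of $(N,c)$. Associated game with a priori unions $(\bar N,\bar c,\bar{\mathcal{B}})$: given $(N,c,\mathcal{B})$, for $i\in B_q$ let $i(q)$ be the representative of $i$ in $B_q$, chosen so that $i(q)\ne j(r)$ if $i\neq j$ or $q\neq r$ (e.g. $i(q)=(i,q)$). Put $M_i=\{i(q): B_q\in\mathcal{B}^i\}$, $\bar N=\bigcup_{i\in N}M_i$, $\bar B_q=\{i(q): i\in B_q\}$, $\bar{\mathcal{B}}=\{\bar B_1,\dots,\bar B_m\}$ (a partition of $\bar N$), and $\bar c(\bar S)=c(\{i\in N: M_i\cap\bar S\ne\emptyset\})$ for $\bar S\subseteq\bar N$. For $k\in B_p$, $\bar{\mathcal{B}}_{-k(p)}$ denotes the partition of $\bar N$ obtained from $\bar{\mathcal{B}}$ by replacing $\bar B_p$ by the two blocks $\bar B_p\setminus\{k(p)\}$ and $\{k(p)\}$. (ADD-R) For every $(N,c,\mathcal{B})$ and $i\in N$: $\psi_i(N,c,\mathcal{B})=\sum_{q: B_q\in\mathcal{B}^i}\psi_{i(q)}(\bar N,\bar c,\bar{\mathcal{B}})$. (BC-CC) For every $(N,c,\mathcal{B})$ and every pair $i,j\in N$ with $\mathcal{B}^i=\mathcal{B}^j$: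 $\psi_i(N,c,\mathcal{B})-\psi_j(N,c,\mathcal{B})=\sum_{q: B_q\in\mathcal{B}^i}\big(\psi_{i(q)}(\bar N,\bar c,\bar{\mathcal{B}}_{-j(q)})-\psi_{j(q)}(\bar N,\bar c,\bar{\mathcal{B}}_{-i(q)})\big)$. (CQ) For every $(N,c,\mathcal{B})$ and every $B_q\in\mathcal{B}$: $\sum_{j\in B_q}\psi_{j(q)}(\bar N,\bar c,\bar{\mathcal{B}})=\psi_q(M,c^{\mathcal{B}},\hat{\mathcal{B}})$, where $M=\{1,\dots,m\}$, $c^{\mathcal{B}}(W)=c\big(\bigcup_{k\in W}B_k\big)$ for $W\subseteq M$, and $\hat{\mathcal{B}}=\{\{1\},\dots,\{m\}\}$. *)

(* Defs.v *)
From mathcomp Require Import all_boot all_order all_algebra.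
From mathcomp Require Import reals.

Set Implicit Arguments.
Unset Strict Implicit.
Unset Printing Implicit Defensive.

Import Order.TTheory GRing.Theory Num.Theory.
Local Open Scope ring_scope.

(* A family {B_1, ..., B_m} of coalitions is a function B : 'I_m -> {set N};
   its blocks may overlap and may be repeated.  A subfamily is represented by
   its set of indices, so that |C| counts indices. *)

Section Games.
Variables (R : realType) (N : finType).

Definition cost_game (c : {set N} -> R) : Prop := c set0 = 0.

Definition coalition_configuration (m : nat) (B : 'I_m -> {set N}) : Prop :=
  (forall q, B q != set0) /\ \bigcup_q B q = [set: N].

Definition game_cc (c : {set N} -> R) (m : nat) (B : 'I_m -> {set N}) : Prop :=
  cost_game c /\ coalition_configuration B.

Definition blocks_of (m : nat) (B : 'I_m -> {set N}) (i : N) : {set 'I_m} :=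
  [set q | i \in B q].

Definition block_union (m : nat) (B : 'I_m -> {set N}) (C : {set 'I_m}) :
  {set N} := \bigcup_(r in C) B r.

(* {{i} : i in N}, listed in an arbitrary order without repetition *)
Definition trivial_configuration (m : nat) (B : 'I_m -> {set N}) : Prop :=
  exists s : 'I_m -> N, bijective s /\ forall k, B k = [set s k].

Definition shapley (c : {set N} -> R) (i : N) : R :=
  \sum_(S : {set N} | i \notin S)
    (#|S|`! * (#|N| - #|S| - 1)`!)%:R / (#|N|`!)%:R * (c (i |: S) - c S).

Definition CV (c : {set N} -> R) (m : nat) (B : 'I_m -> {set N}) (i : N) : R :=
  \sum_(q in blocks_of B i)
  \sum_(C : {set 'I_m} | C :&: blocks_of B i == set0)
  \sum_(S : {set N} | (S \subset B q) && (i \in S))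
    (#|C|`! * (m - #|C| - 1)`!)%:R / (m`!)%:R
    * (((#|S| - 1)`! * (#|B q| - #|S|)`!)%:R / (#|B q|`!)%:R)
    * (c (block_union B C :|: S) - c (block_union B C :|: (S :\ i))).

End Games.

Section AssociatedGame.
Variables (R : realType) (N : finType) (m : nat) (B : 'I_m -> {set N}).

Definition bar_player : Type := {x : N * 'I_m | x.1 \in B x.2}.

(* the representative i(q), for i in B_q *)
Definition rep (q : 'I_m) (i : N) (iBq : i \in B q) : bar_player :=
  exist (fun x : N * 'I_m => x.1 \in B x.2) (i, q) iBq.

(* M_i *)
Definition reps_of (i : N) : {set bar_player} := [set x | (val x).1 == i].

Definition bar_block (q : 'I_m) : {set bar_player} :=
  [set x | (val x).2 == q].

Definition bar_cost (c : {set N} -> R) (S : {set bar_player}) : R :=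
  c [set i | reps_of i :&: S != set0].

(* For x = k(p): block p loses k(p), and {k(p)} is appended as the last block.
   The block p becomes empty when B_p = {k}. *)
Definition bar_split (x : bar_player) (r : 'I_m.+1) : {set bar_player} :=
  if unlift ord_max r is Some s then
    if s == (val x).2 then bar_block s :\ x else bar_block s
  else [set x].

Definition quotient_cost (c : {set N} -> R) (W : {set 'I_m}) : R :=
  c (block_union B W).

Definition quotient_configuration (k : 'I_m) : {set 'I_m} := [set k].

Lemma mem_blocks_of_eq (i j : N) (q : 'I_m) :
  blocks_of B i = blocks_of B j -> i \in B q -> j \in B q.
Proof. by move=> /setP/(_ q); rewrite !inE => ->. Qed.

Lemma game_cc_bar (c : {set N} -> R) :
  game_cc c B -> game_cc (bar_cost c) bar_block.
Proof.
case=> c0 [B0 _]; split.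
  rewrite /cost_game /bar_cost -[RHS]c0; congr c.
  by apply/setP=> i; rewrite !inE setI0 eqxx.
split.
  move=> q; have /set0Pn[i iBq] := B0 q.
  by apply/set0Pn; exists (rep iBq); rewrite inE.
by apply/setP=> x; rewrite inE; apply/bigcupP; exists (val x).2; rewrite ?inE.
Qed.

Lemma game_cc_bar_split (c : {set N} -> R) (x y : bar_player) :
  game_cc c B -> (val x).2 = (val y).2 -> x != y ->
  game_cc (bar_cost c) (bar_split x).
Proof.
move=> /game_cc_bar[c0 [B0 Bcov]] exy neq_xy; split=> //; split.
  move=> r; rewrite /bar_split; case: unlift => [s|]; last first.
    by apply/set0Pn; exists x; rewrite inE.
  case: ifP => [/eqP->|_]; last exact: B0.
  by apply/set0Pn; exists y; rewrite !inE eq_sym neq_xy exy eqxx.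
apply/setP=> z; rewrite inE; apply/bigcupP.
have [->|neq_zx] := eqVneq z x.
  by exists ord_max => //; rewrite /bar_split unlift_none inE.
exists (lift ord_max (val z).2) => //; rewrite /bar_split liftK.
by case: ifP => _; rewrite !inE ?neq_zx eqxx.
Qed.

Lemma game_cc_quotient (c : {set N} -> R) :
  game_cc c B -> game_cc (quotient_cost c) quotient_configuration.
Proof.
case=> c0 _; split; first by rewrite /cost_game /quotient_cost /block_union big_set0.
split=> [k|]; first by apply/set0Pn; exists k; rewrite inE.
by apply/setP=> k; rewrite inE; apply/bigcupP; exists k; rewrite ?inE.
Qed.

End AssociatedGame.

(* Only the values on triples satisfying game_cc are relevant. *)
Definition allocation_rule (R : realType) : Type :=
  forall N : finType, ({set N} -> R) ->
  forall m : nat, ('I_m -> {set N}) -> N -> R.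

Definition CV_rule (R : realType) : allocation_rule R :=
  fun N c m B i => CV c B i.

Section Properties.
Variables (R : realType) (psi : allocation_rule R).

Definition configurational_shapley : Prop :=
  forall (N : finType) (c : {set N} -> R) (m : nat) (B : 'I_m -> {set N}),
    game_cc c B -> trivial_configuration B ->
    forall i : N, psi c B i = shapley c i.

Definition ADD_R : Prop :=
  forall (N : finType) (c : {set N} -> R) (m : nat) (B : 'I_m -> {set N}),
    game_cc c B ->
    forall i : N,
      psi c B i =
      \sum_(q : {q : 'I_m | i \in B q})
        psi (bar_cost (B := B) c) (bar_block B) (rep (valP q)).

(* When i = j both sides vanish; otherwise the configurations on the right are
   genuine ones by game_cc_bar_split. *)
Definition BC_CC : Prop :=
  forall (N : finType) (c : {set N} -> R) (m : nat) (B : 'I_m -> {set N}),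
    game_cc c B ->
    forall (i j : N) (Bij : blocks_of B i = blocks_of B j),
      psi c B i - psi c B j =
      \sum_(q : {q : 'I_m | i \in B q})
        let iq := rep (valP q) in
        let jq := rep (mem_blocks_of_eq Bij (valP q)) in
        psi (bar_cost (B := B) c) (bar_split jq) iq
        - psi (bar_cost (B := B) c) (bar_split iq) jq.

Definition CQ : Prop :=
  forall (N : finType) (c : {set N} -> R) (m : nat) (B : 'I_m -> {set N}),
    game_cc c B ->
    forall q : 'I_m,
      \sum_(j : {j : N | j \in B q})
        psi (bar_cost (B := B) c) (bar_block B) (rep (valP j)) =
      psi (quotient_cost B c) (@quotient_configuration m) q.

End Properties.

(* Main.v *)
Require Import Defs.
From mathcomp Require Import all_boot all_order all_algebra.
From mathcomp Require Import reals.
From mathcomp Require Import ring lra zify.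

Set Implicit Arguments.
Unset Strict Implicit.
Unset Printing Implicit Defensive.

Import Order.TTheory GRing.Theory Num.Theory.
Local Open Scope ring_scope.

(* The configuration value of i in the block B_q is a weighted sum, over the
   subfamilies C avoiding B^i, of the Shapley value of i in the game
   S |-> c (A_C U S) on B_q (shapley_on below).  ADD-R and CQ then reduce to
   reindexing and to efficiency of these inner Shapley values, and BC-CC to
   balanced contributions of the inner values together with the identity
   w(k, m + 1) + w(k + 1, m + 1) = w(k, m) for the coalition weights.
   Uniqueness: by ADD-R it suffices to treat families of disjoint blocks.  There
   BC-CC fixes the differences inside a block, by induction on #|N| - m, and CQ
   fixes the block sums as Shapley values of the quotient game. *)

(** * Sums over the subsets of a finite set *)

Section Subsets.
Variables (V : nmodType) (K : finType).

Lemma sum_subsets_split (D : {set K}) (j : K) (F : {set K} -> V) :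
  j \in D ->
  \sum_(T : {set K} | T \subset D) F T =
  \sum_(T : {set K} | T \subset D :\ j) (F T + F (j |: T)).
Proof.
move=> jD; rewrite big_split (bigID (fun T : {set K} => j \in T)) /= addrC.
congr (_ + _); first by apply: eq_bigl => T; rewrite subsetD1.
rewrite (reindex_onto (fun T => j |: T) (fun T => T :\ j)) /=; last first.
  by move=> T /andP[_ jT]; rewrite setD1K.
apply: eq_bigl => T; rewrite setU11 andbT subUset sub1set jD subsetD1 /=.
congr (_ && _); apply/eqP/idP => [<-|]; first by rewrite setD11.
exact: setU1K.
Qed.

Lemma sum_subsets_imset (L : finType) (h : K -> L) (D : {set K})
    (F : {set L} -> V) :
  {in D &, injective h} ->
  \sum_(T : {set L} | T \subset h @: D) F T =
  \sum_(T : {set K} | T \subset D) F (h @: T).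
Proof.
move=> h_inj.
(* The inverse is the preimage cut down to [D], as [h] may identify points outside [D]. *)
rewrite (reindex_onto (fun T : {set K} => h @: T) (fun T => D :&: h @^-1: T)) /=.
  apply: eq_bigl => T; apply/andP/idP => [[_ /eqP<-]|sTD].
    exact: subsetIl.
  rewrite imsetS //; split=> //; apply/eqP/setP=> x; rewrite !inE.
  apply/andP/idP => [[xD /imsetP[y yT hxy]]|xT].
    by rewrite (h_inj x y) // (subsetP sTD).
  by rewrite (subsetP sTD) // imset_f.
move=> T sT; apply/setP=> y; apply/imsetP/idP => [[x]|yT].
  by rewrite !inE => /andP[_ ?] ->.
have /imsetP[x xD yE] := subsetP sT y yT.
by exists x => //; rewrite !inE xD -yE.
Qed.

End Subsets.

(** * Shapley weights and Shapley values on a subset of the players *)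

Section ShapleyOn.
Variable R : realType.

Definition weight (k n : nat) : R := (k`! * (n - k - 1)`!)%:R / n`!%:R.

(** [weight k n] is the probability that, in a random order of [n] players, the predecessors of a
    given player form a given set of size [k]. An extra player comes either after the given one or
    before it, which yields the two terms on the left. *)
Lemma weight_pascal (k n : nat) :
  (k < n)%N -> weight k n.+1 + weight k.+1 n.+1 = weight k n.
Proof.
move=> ltkn; rewrite /weight -(subnKC ltkn); set p := (n - k.+1)%N.
have -> : ((k.+1 + p).+1 - k - 1 = p.+1)%N by lia.
have -> : ((k.+1 + p).+1 - k.+1 - 1 = p)%N by lia.
rewrite [((k.+1 + p).+1)`!]factS [(p.+1)`!]factS [(k.+1)`!]factS.
have n0 : (k.+1 + p)`!%:R != 0 :> R by rewrite pnatr_eq0 -lt0n fact_gt0.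
have s0 : (k.+1 + p).+1%:R != 0 :> R by rewrite pnatr_eq0.
rewrite -mulrDl; set N := (k.+1 + p)%N in n0 s0 *; rewrite (natrM _ N.+1).
apply/eqP; rewrite eqr_div ?mulf_neq0 //; apply/eqP.
by rewrite !natrM /N; ring.
Qed.

(** This is the coefficient of a coalition of size [s] in the sum of all Shapley values: its [s]
    members count it positively, the [d - s] others negatively. Both products equal
    [s! (d - s)! / d!] when [0 < s < d]. *)
Lemma weight_balance (s d : nat) : (s <= d)%N ->
  s%:R * weight s.-1 d - (d - s)%:R * weight s d =
  (s == d)%:R - (s == 0%N)%:R.
Proof.
have f0 n : n`!%:R != 0 :> R by rewrite pnatr_eq0 -lt0n fact_gt0.
rewrite /weight; case: s => [_|s /subnKC <-] /=.
  rewrite mul0r !subn0; case: d => [|d]; first by rewrite mul0r !subrr.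
  rewrite fact0 mul1n subn1 /= mulrA -natrM -factS divff //.
have -> : (s.+1 + (d - s.+1) - s - 1 = d - s.+1)%N by lia.
rewrite addKn subr0; case: (d - s.+1)%N => [|p].
  by rewrite addn0 eqxx mul0r subr0 mulrA -natrM fact0 muln1 -factS divff.
have -> : (s.+1 == s.+1 + p.+1)%N = false by lia.
by rewrite subn1 /= !factS !natrM; ring.
Qed.

Section OneSet.
Variable K : finType.
Implicit Types (D T : {set K}) (f : {set K} -> R).

(** The players form a subset of an ambient type and [f set0] may be nonzero, as happens for the
    games [S |-> c (A_C U S)] on a block. *)
Definition shapley_on D f (i : K) : R :=
  \sum_(T : {set K} | T \subset D :\ i) weight #|T| #|D| * (f (i |: T) - f T).

Lemma eq_shapley_on D f g i :
  i \in D -> (forall T, T \subset D -> f T = g T) ->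
  shapley_on D f i = shapley_on D g i.
Proof.
move=> iD fg; apply: eq_bigr => T; rewrite subsetD1 => /andP[sTD _].
by rewrite !fg // subUset sub1set iD.
Qed.

Lemma shapley_on_setT f i : shapley_on [set: K] f i = shapley f i.
Proof.
rewrite /shapley_on /shapley cardsT; apply: eq_bigl => T.
by rewrite subsetD1 subsetT.
Qed.

Lemma shapley_on_set1 f i : shapley_on [set i] f i = f [set i] - f set0.
Proof.
rewrite /shapley_on setDv (big_pred1 set0) => [|T]; last by rewrite subset0.
rewrite cards0 cards1 setU0 /weight subn0 subnn fact0 muln1.
by rewrite divff ?mul1r ?oner_eq0.
Qed.

(** Collecting the terms by coalition gives the coefficients of [weight_balance], so only [D] and
    [set0] survive. *)
Lemma shapley_on_efficient D f :
  \sum_(i in D) shapley_on D f i = f D - f set0.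
Proof.
transitivity (\sum_(T : {set K} | T \subset D)
  (#|T|%:R * weight #|T|.-1 #|D| - (#|D| - #|T|)%:R * weight #|T| #|D|) * f T).
  under [RHS]eq_bigr do rewrite mulrBl; rewrite sumrB.
  under eq_bigr => i iD.
    rewrite /shapley_on; under eq_bigr do rewrite mulrBr; rewrite sumrB.
    (* The positive terms are indexed by the coalition after [i] has joined, so that [f T] appears
       in both sums. *)
    rewrite (reindex_onto (fun T => T :\ i) (fun T => i |: T)) /=; last first.
      by move=> T; rewrite subsetD1 => /andP[_ iT]; rewrite setU1K.
    over.
  rewrite sumrB; congr (_ - _).
    rewrite (exchange_big_dep (fun T : {set K} => T \subset D)) /=.
      apply: eq_bigr => T sTD.
      rewrite (eq_bigl (fun i => i \in T)) => [|i].
        rewrite (eq_bigr (fun=> weight #|T|.-1 #|D| * f T)) => [|i iT].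
          by rewrite sumr_const -[RHS]mulrA mulr_natl.
        by rewrite setD1K // (cardsD1 i T) iT.
      apply/andP/idP => [[_ /andP[_ /eqP<-]]|iT]; first exact: setU11.
      by rewrite setD1K // eqxx setSD // (subsetP sTD).
    move=> i T iD /andP[sT /eqP<-].
    by rewrite subUset sub1set iD (subset_trans sT) ?subD1set.
  rewrite (exchange_big_dep (fun T : {set K} => T \subset D)) /=.
    apply: eq_bigr => T sTD.
    rewrite (eq_bigl (fun i => i \in D :\: T)) => [|i].
      by rewrite sumr_const cardsD (setIidPr sTD) -[RHS]mulrA mulr_natl.
    by rewrite inE subsetD1 sTD andbC.
  by move=> i T iD; rewrite subsetD1 => /andP[].
rewrite (eq_bigr (fun T => ((T == D)%:R - (T == set0)%:R) * f T)).
  under eq_bigr do rewrite mulrBl; rewrite sumrB; congr (_ - _).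
    rewrite (bigD1 D) //= eqxx mul1r big1 ?addr0 // => T /andP[_ /negPf->].
    exact: mul0r.
  rewrite (bigD1 set0) ?sub0set //= eqxx mul1r big1 ?addr0 //.
  by move=> T /andP[_ /negPf->]; rewrite mul0r.
move=> T sTD; rewrite weight_balance ?subset_leq_card // cards_eq0.
by rewrite (eqEcard T D) sTD eqn_leq subset_leq_card.
Qed.

Section Pair.
Variables (D : {set K}) (i j : K) (iD : i \in D) (jD : j \in D) (ij : i != j).
Variable f : {set K} -> R.

(** Common value of the three differences below; their equality is the balanced contributions
    property of the Shapley value. *)
Let pair_diff : R :=
  \sum_(T : {set K} | T \subset D :\ i :\ j)
    weight #|T| #|D|.-1 * (f (i |: T) - f (j |: T)).

Let cardD1 k : k \in D -> #|D :\ k| = #|D|.-1.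
Proof. by move=> kD; rewrite [in RHS](cardsD1 k) kD. Qed.

Lemma setD1C (k l : K) : D :\ k :\ l = D :\ l :\ k.
Proof. by rewrite !setDDl setUC. Qed.

(** Coalitions without and with the other player contribute the same difference
    [f (i |: T) - f (j |: T)], and their weights add up by [weight_pascal]. *)
Lemma shapley_on_diff : shapley_on D f i - shapley_on D f j = pair_diff.
Proof.
rewrite /shapley_on (@sum_subsets_split _ _ _ j) ?in_setD1 1?eq_sym ?ij //.
rewrite (@sum_subsets_split _ _ (D :\ j) i) ?in_setD1 ?ij // setD1C.
rewrite -sumrB [RHS](eq_bigl (fun T => T \subset D :\ j :\ i)); last first.
  by move=> T; rewrite setD1C.
apply: eq_bigr => T; rewrite !subsetD1 -andbA => /and3P[sTD jT iT].
have ltTD : (#|T| < #|D|.-1)%N.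
  rewrite -(cardD1 jD) (cardsD1 i (D :\ j)) in_setD1 ij iD ltnS.
  by rewrite subset_leq_card // !subsetD1 sTD jT iT.
rewrite -(weight_pascal ltTD) prednK ?(leq_ltn_trans _ ltTD) //; last first.
  by rewrite card_gt0; apply/set0Pn; exists i.
by rewrite !cardsU1 jT iT !add1n setUCA; ring.
Qed.

Lemma shapley_on_D1_diff :
  shapley_on (D :\ j) f i - shapley_on (D :\ i) f j = pair_diff.
Proof.
rewrite /shapley_on /pair_diff !cardD1 // setD1C -sumrB.
by rewrite setD1C; apply: eq_bigr => T _; ring.
Qed.

(** Here the removed player has already joined, as when its singleton block belongs to the subfamily
    [C]. *)
Lemma shapley_on_D1U_diff :
  shapley_on (D :\ j) (fun S => f (j |: S)) i -
  shapley_on (D :\ i) (fun S => f (i |: S)) j = pair_diff.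
Proof.
rewrite /shapley_on /pair_diff !cardD1 // setD1C -sumrB.
by rewrite setD1C; apply: eq_bigr => T _; rewrite setUCA; ring.
Qed.

End Pair.
End OneSet.

(** Invariance under relabelling. Injectivity is asked on [D] only, because the projection of
    representatives to players is injective merely on each block. *)
Lemma shapley_on_imset (K L : finType) (h : K -> L) (D : {set K})
    (f : {set L} -> R) (i : K) :
  i \in D -> {in D &, injective h} ->
  shapley_on (h @: D) f (h i) = shapley_on D (fun T => f (h @: T)) i.
Proof.
move=> iD h_inj; rewrite /shapley_on.
have -> : h @: D :\ h i = h @: (D :\ i).
  apply/setP=> y; rewrite !inE; apply/andP/imsetP => [[yi /imsetP[x xD yE]]|[x]].
    exists x => //; rewrite !inE xD andbT.
    by apply: contraNneq yi => <-; rewrite yE.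
  rewrite !inE => /andP[xi xD] ->; rewrite imset_f //; split=> //.
  by apply: contraNneq xi => /h_inj->.
rewrite sum_subsets_imset => [|x y]; last first.
  by rewrite !inE => /andP[_ ?] /andP[_ ?]; exact: h_inj.
apply: eq_bigr => T; rewrite subsetD1 => /andP[sTD _].
rewrite imsetU1 !card_in_imset //.
by move=> x y xT yT; apply: h_inj; apply: (subsetP sTD).
Qed.

End ShapleyOn.

(** * The configuration value through inner Shapley values *)

Section ConfigurationValue.
Variables (R : realType) (N : finType) (c : {set N} -> R) (m : nat).
Variable B : 'I_m -> {set N}.

Lemma CV_shapley_on (i : N) :
  CV c B i = \sum_(q in blocks_of B i)
    \sum_(C : {set 'I_m} | C :&: blocks_of B i == set0)
      weight R #|C| m *
      shapley_on (B q) (fun S => c (block_union B C :|: S)) i.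
Proof.
apply: eq_bigr => q; rewrite inE => iBq; apply: eq_bigr => C _.
rewrite /shapley_on mulr_sumr.
rewrite (reindex_onto (fun T => i |: T) (fun S => S :\ i)) /=; last first.
  by move=> S /andP[_ iS]; rewrite setD1K.
apply: eq_big => T => [|/andP[_ /eqP TE]].
  rewrite subUset sub1set iBq setU11 andbT subsetD1 /=; congr (_ && _).
  apply/eqP/idP => [<-|]; first by rewrite setD11.
  exact: setU1K.
have iT : i \notin T by rewrite -TE setD11.
by rewrite TE cardsU1 iT addKn subnDA (subnAC #|B q|) -[LHS]mulrA.
Qed.

Lemma CV_single_block (i : N) (q : 'I_m) :
  blocks_of B i = [set q] ->
  CV c B i = \sum_(C : {set 'I_m} | C \subset [set: 'I_m] :\ q)
    weight R #|C| m * shapley_on (B q) (fun S => c (block_union B C :|: S)) i.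
Proof.
move=> Bi; rewrite CV_shapley_on Bi big_set1; apply: eq_bigl => C.
by rewrite setI_eq0 disjoint_sym disjoints1 subsetD1 subsetT.
Qed.

(** For one-player blocks the inner Shapley value is a single marginal contribution, and [s] turns
    subfamilies into coalitions. *)
Lemma CV_trivial (i : N) :
  trivial_configuration B -> CV c B i = shapley c i.
Proof.
case=> s [s_bij Bs]; have s_inj := bij_inj s_bij.
case: (s_bij) => t ts st; rewrite -(st i).
rewrite (@CV_single_block _ (t i)); last first.
  by apply/setP=> r; rewrite !inE Bs inE (inj_eq s_inj) eq_sym.
rewrite -shapley_on_setT; have <- : s @: [set: 'I_m] = [set: N].
  by apply/setP=> j; rewrite inE -(st j) imset_f.
rewrite shapley_on_imset //; last by move=> ? ? _ _; exact: s_inj.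
have unionE (C : {set 'I_m}) : block_union B C = s @: C.
  apply/setP=> j; apply/bigcupP/imsetP => -[r rC].
    by rewrite Bs => /set1P->; exists r.
  by move=> ->; exists r; rewrite // Bs set11.
apply: eq_big => [//|C _]; rewrite Bs shapley_on_set1 cardsT card_ord.
by rewrite setU0 unionE imsetU1 setUC.
Qed.

End ConfigurationValue.

(** * The associated game with a priori unions *)

Section Bar.
Variables (R : realType) (N : finType) (c : {set N} -> R) (m : nat).
Variable B : 'I_m -> {set N}.
Implicit Types (x y : bar_player B) (S : {set bar_player B}) (C : {set 'I_m}).

Let proj x : N := (val x).1.

Lemma bar_costE S : bar_cost c S = c (proj @: S).
Proof.
congr c; apply/setP=> i; rewrite inE; apply/set0Pn/imsetP => [[x]|[x xS ->]].
  by rewrite !inE => /andP[/eqP <- xS]; exists x.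
by exists x; rewrite !inE eqxx.
Qed.

Lemma bar_block_proj q : proj @: bar_block B q = B q.
Proof.
apply/setP=> i; apply/imsetP/idP => [[x]|iBq].
  by rewrite inE => /eqP <- ->; exact: (valP x).
by exists (rep iBq); rewrite ?inE.
Qed.

Lemma bar_block_inj q : {in bar_block B q &, injective proj}.
Proof.
move=> x y; rewrite !inE => /eqP xq /eqP yq; rewrite /proj => xy.
apply: val_inj; rewrite [LHS]surjective_pairing [RHS]surjective_pairing.
by rewrite xy xq yq.
Qed.

Lemma block_union_proj C :
  proj @: block_union (@bar_block N m B) C = block_union B C.
Proof.
apply/setP=> i; apply/imsetP/bigcupP => [[x /bigcupP[r rC]]|[r rC iBr]].
  by rewrite inE => /eqP xr ->; exists r => //; rewrite -xr; exact: (valP x).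
by exists (rep iBr) => //; apply/bigcupP; exists r; rewrite ?inE.
Qed.

Lemma blocks_of_bar x : blocks_of (@bar_block N m B) x = [set (val x).2].
Proof. by apply/setP=> r; rewrite !inE eq_sym. Qed.

(** Projection identifies each inner game on a bar block with the one on the original block. A
    representative lies in one block only, so [C] just has to avoid that block. *)
Lemma CV_bar x :
  CV (bar_cost c) (@bar_block N m B) x =
  \sum_(C : {set 'I_m} | C \subset [set: 'I_m] :\ (val x).2)
    weight R #|C| m *
    shapley_on (B (val x).2) (fun T => c (block_union B C :|: T)) (val x).1.
Proof.
rewrite (CV_single_block _ (blocks_of_bar x)); apply: eq_bigr => C _.
rewrite -bar_block_proj shapley_on_imset; last 2 first.
- by rewrite inE.
- exact: bar_block_inj.
congr (_ * _); apply: eq_shapley_on => [|S _]; first by rewrite inE.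
by rewrite bar_costE imsetU block_union_proj.
Qed.

(** By [CV_bar] the right side has extra subfamilies, those with another block containing [i]. They
    contribute zero, since [i] already belongs to the union of [C]. *)
Lemma CV_additive (i : N) :
  CV c B i = \sum_(q : {q : 'I_m | i \in B q})
    CV (bar_cost c) (@bar_block N m B) (rep (valP q)).
Proof.
rewrite CV_shapley_on (eq_bigl (fun q => i \in B q)); last first.
  by move=> q; rewrite inE.
rewrite (big_sub (fun q => i \in B q)); apply: eq_bigr => -[q /= iBq] _.
rewrite CV_bar /=; apply/esym.
rewrite (bigID (fun C => C :&: blocks_of B i == set0)) /= addrC big1 ?add0r.
  apply: eq_bigl => C; rewrite subsetD1 subsetT /=.
  apply/andP/idP => [[]//|Ci0]; split=> //; apply: contraL Ci0 => qC.
  by apply/set0Pn; exists q; rewrite !inE qC.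
move=> C /andP[_ /set0Pn[r]]; rewrite !inE => /andP[rC iBr].
rewrite /shapley_on big1 ?mulr0 // => T _.
have iC : i \in block_union B C by apply/bigcupP; exists r.
by rewrite setUCA [i |: _](setUidPr _) ?subrr ?mulr0 // sub1set inE iC.
Qed.

(** Efficiency inside [B q] leaves [c (A_C U B_q) - c A_C], the marginal contribution of [q] in the
    quotient game. *)
Lemma CV_quotient (q : 'I_m) :
  \sum_(j : {j : N | j \in B q})
     CV (bar_cost c) (@bar_block N m B) (rep (valP j)) =
  CV (quotient_cost B c) (@quotient_configuration m) q.
Proof.
rewrite (@CV_single_block _ _ _ _ _ _ q); last first.
  by apply/setP=> r; rewrite !inE eq_sym.
under eq_bigr do rewrite CV_bar /=.
rewrite exchange_big /=; apply: eq_bigr => C _.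
rewrite -mulr_sumr shapley_on_set1; congr (_ * _).
rewrite -(big_sub (B q) (shapley_on (B q) (fun T => c (block_union B C :|: T)))).
rewrite shapley_on_efficient setU0 setU0 /quotient_cost.
have unionE (D : {set 'I_m}) : block_union (@quotient_configuration m) D = D.
  apply/setP=> r; apply/bigcupP/idP => [[k kD /set1P->] //|rD].
  by exists r; rewrite ?set11.
by rewrite unionE /block_union bigcup_setU big_set1.
Qed.

Let F C S : R := bar_cost c (block_union (@bar_block N m B) C :|: S).

Lemma CV_bar_split x y : (val x).2 = (val y).2 -> x != y ->
  CV (bar_cost c) (bar_split y) x =
  \sum_(C : {set 'I_m} | C \subset [set: 'I_m] :\ (val x).2)
    (weight R #|C| m.+1 * shapley_on (bar_block B (val x).2 :\ y) (F C) x
     + weight R #|C|.+1 m.+1 *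
       shapley_on (bar_block B (val x).2 :\ y) (fun S => F C (y |: S)) x).
Proof.
move=> xy neq_xy; set q := (val x).2.
have splitE r : bar_split y (lift ord_max r) =
    if r == q then bar_block B q :\ y else bar_block B r.
  by rewrite /bar_split liftK /q xy; case: eqP => [->|].
have splitM : bar_split y ord_max = [set y] by rewrite /bar_split unlift_none.
have unionE C : C \subset [set: 'I_m] :\ q ->
    block_union (bar_split y) (lift ord_max @: C) =
    block_union (@bar_block N m B) C.
  rewrite subsetD1 => /andP[_ qC]; rewrite /block_union big_imset /=.
    apply: eq_bigr => r rC; rewrite splitE; case: eqP => // rq.
    by rewrite -rq rC in qC.
  by move=> ? ? _ _; exact: lift_inj.
(* As [x != y], [x] stays in the old block, now at index [lift ord_max q]. *)
rewrite (@CV_single_block _ _ _ _ _ _ (lift ord_max q)); last first.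
  apply/setP=> r; rewrite !inE.
  case: (unliftP ord_max r) => [s ->|->]; last first.
    by rewrite splitM inE (negPf neq_xy) (negPf (neq_lift _ _)).
  rewrite splitE (inj_eq lift_inj) [s == q]eq_sym.
  by case: ifP => [|/negPf qs]; rewrite !inE ?neq_xy ?eqxx // qs.
(* Subfamilies are paired according to whether they contain the appended block [[set y]]; containing
   it raises their size by one and puts [y] into their union. *)
rewrite splitE eqxx (@sum_subsets_split _ _ _ ord_max) ?inE ?neq_lift //.
have -> : [set: 'I_m.+1] :\ lift ord_max q :\ ord_max =
          lift ord_max @: ([set: 'I_m] :\ q).
  apply/setP=> r; rewrite !inE andbT; case: (unliftP ord_max r) => [s ->|->].
    rewrite mem_imset; last exact: lift_inj.
    by rewrite eq_sym neq_lift (inj_eq lift_inj) !inE andbT.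
  rewrite eqxx; apply/esym/imsetP => -[s _ /eqP].
  by rewrite (negPf (neq_lift _ _)).
rewrite sum_subsets_imset; last by move=> ? ? _ _; exact: lift_inj.
apply: eq_bigr => C sC.
have maxC : ord_max \notin lift ord_max @: C.
  by apply/imsetP => -[r _ /eqP]; rewrite (negPf (neq_lift _ _)).
rewrite cardsU1 maxC card_imset; last exact: lift_inj.
rewrite add1n unionE //; congr (_ + _ * _).
apply: eq_shapley_on => [|S _]; first by rewrite !inE neq_xy eqxx.
rewrite /F {1}/block_union big_setU1 //= splitM -/(block_union _ _) unionE //.
by rewrite setUCA setUA.
Qed.

Lemma CV_bar_balanced x y : (val x).2 = (val y).2 ->
  CV (bar_cost c) (@bar_block N m B) x - CV (bar_cost c) (@bar_block N m B) y =
  CV (bar_cost c) (bar_split y) x - CV (bar_cost c) (bar_split x) y.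
Proof.
move=> xy; have [->|neq_xy] := eqVneq x y; first by rewrite !subrr.
rewrite !(CV_single_block _ (blocks_of_bar _)) CV_bar_split //.
rewrite CV_bar_split 1?eq_sym // -xy -!sumrB; apply: eq_bigr => C sC.
(* [C] omits the block of [x], which gives the strict bound required by [weight_pascal]. *)
have ltCm : (#|C| < m)%N.
  rewrite -[X in (_ < X)%N]card_ord -cardsT; apply: proper_card.
  rewrite properEneq subsetT andbT; apply: contraTneq sC => ->.
  by rewrite subsetD1 inE andbF.
have xq : x \in bar_block B (val x).2 by rewrite inE.
have yq : y \in bar_block B (val x).2 by rewrite inE xy.
rewrite -mulrBr shapley_on_diff // opprD addrACA -!mulrBr.
rewrite shapley_on_D1_diff // shapley_on_D1U_diff //.
by rewrite -mulrDl weight_pascal.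
Qed.

End Bar.

(** * The four properties of [CV_rule] *)

Section Characterization.
Variable R : realType.

Lemma CV_configurational_shapley : configurational_shapley (@CV_rule R).
Proof. by move=> N c m B _ trivB i; exact: CV_trivial. Qed.

Lemma CV_ADD_R : ADD_R (@CV_rule R).
Proof. by move=> N c m B _ i; exact: CV_additive. Qed.

Lemma CV_BC_CC : BC_CC (@CV_rule R).
Proof.
move=> N c m B _ i j Bij; rewrite /CV_rule !CV_additive.
have memE q : (i \in B q) = (j \in B q).
  by move/setP: Bij => /(_ q); rewrite !inE.
(* The sums for [i] and [j] range over different subtypes of indices, matched by [g]. *)
pose g (q : {q : 'I_m | i \in B q}) : {q : 'I_m | j \in B q} :=
  exist _ (val q) (mem_blocks_of_eq Bij (valP q)).
have g_bij : {on predT, bijective g}.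
  exists (fun q : {q : 'I_m | j \in B q} =>
    exist (fun q => i \in B q) (val q) (etrans (memE (val q)) (valP q))).
    by move=> q _; apply: val_inj.
  by move=> q _; apply: val_inj.
rewrite [X in _ - X](reindex g) //= -sumrB; apply: eq_bigr => q _.
rewrite -CV_bar_balanced //; congr (_ - CV _ _ _); exact: val_inj.
Qed.

Lemma CV_CQ : CQ (@CV_rule R).
Proof. by move=> N c m B _ q; exact: CV_quotient. Qed.

(** * Families of disjoint blocks *)

Definition disjoint_blocks (N : finType) (m : nat) (B : 'I_m -> {set N}) :=
  forall i q r, i \in B q -> i \in B r -> q = r.

Lemma disjoint_bar_block (N : finType) (m : nat) (B : 'I_m -> {set N}) :
  disjoint_blocks (@bar_block N m B).
Proof. by move=> x q r; rewrite !inE => /eqP <- /eqP. Qed.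

Lemma disjoint_bar_split (N : finType) (m : nat) (B : 'I_m -> {set N})
    (x : bar_player B) : disjoint_blocks (bar_split x).
Proof.
move=> y q r; rewrite /bar_split.
case: unliftP => [s ->|->]; case: unliftP => [t ->|->] //.
- move=> ys yt; congr (lift _ _).
  apply: (@disjoint_bar_block _ _ B y).
    by case: ifP ys => // _; rewrite inE => /andP[].
  by case: ifP yt => // _; rewrite inE => /andP[].
- rewrite [in X in _ -> X]inE => + /eqP yx; rewrite yx.
  by case: eqP => [_|+]; rewrite !inE ?eqxx // => /[swap] /eqP->.
- rewrite inE => /eqP ->.
  by case: eqP => [_|+]; rewrite !inE ?eqxx // => /[swap] /eqP->.
Qed.

(** Choosing one element in each block is an injection of the indices into the players. *)
Lemma disjoint_blocks_leq (N : finType) (m : nat) (B : 'I_m -> {set N}) :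
  (forall q, B q != set0) -> disjoint_blocks B -> (m <= #|N|)%N.
Proof.
move=> B0 disjB.
have pickB q : exists i, i \in B q by apply/set0Pn.
rewrite -[m]card_ord; apply: (@leq_card _ _ (fun q => xchoose (pickB q))).
move=> q r qr; apply: (disjB (xchoose (pickB q))); first exact: xchooseP.
by rewrite qr; exact: xchooseP.
Qed.

Lemma card_bar_player (N : finType) (m : nat) (B : 'I_m -> {set N}) :
  disjoint_blocks B -> (#|{: bar_player B}| <= #|N|)%N.
Proof.
move=> disjB; apply: (@leq_card _ _ (fun x : bar_player B => (val x).1)).
move=> x y xy; apply: val_inj.
have xy2 : (val x).2 = (val y).2.
  by apply: (disjB (val x).1); [exact: (valP x) | rewrite xy; exact: (valP y)].
by rewrite [LHS]surjective_pairing [RHS]surjective_pairing xy xy2.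
Qed.

(** * Agreement of two rules with the four properties *)

Section Uniqueness.
Variables psi phi : allocation_rule R.
Hypotheses (psiS : configurational_shapley psi) (psiA : ADD_R psi)
  (psiB : BC_CC psi) (psiQ : CQ psi).
Hypotheses (phiS : configurational_shapley phi) (phiA : ADD_R phi)
  (phiB : BC_CC phi) (phiQ : CQ phi).

(** The sum in ADD-R has a single term here, so CQ can be read in the original game. *)
Lemma ADD_R_disjoint (rho : allocation_rule R) (N : finType) c (m : nat)
    (B : 'I_m -> {set N}) i q (iBq : i \in B q) :
  ADD_R rho -> game_cc c B -> disjoint_blocks B ->
  rho N c m B i = rho _ (bar_cost (B := B) c) m (bar_block B) (rep iBq).
Proof.
move=> rhoA gameB disjB; rewrite rhoA // (big_pred1 (exist _ q iBq)) /=.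
  by congr rho; apply: val_inj.
by move=> [r iBr]; apply/esym/eqP/val_inj; exact: disjB iBr iBq.
Qed.

Lemma rules_agree_quotient (N : finType) c (m : nat) (B : 'I_m -> {set N}) q :
  game_cc c B ->
  psi (quotient_cost B c) (@quotient_configuration m) q =
  phi (quotient_cost B c) (@quotient_configuration m) q.
Proof.
move=> /game_cc_quotient gameQ.
have trivQ : trivial_configuration (@quotient_configuration m).
  by exists id; split=> //; exists id.
by rewrite psiS // phiS.
Qed.

(* Balanced contributions are evaluated at configurations with one more block
   and no more players, whence the induction on #|N| - m. *)
Lemma rules_agree_disjoint (N : finType) (c : {set N} -> R) (m : nat)
    (B : 'I_m -> {set N}) (i : N) :
  game_cc c B -> disjoint_blocks B -> psi c B i = phi c B i.
Proof.
have [n] := ubnP (#|N| - m)%N.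
elim: n N c m B i => // n IHn N c m B i lt_n gameB disjB.
have agree_split (x y : bar_player B) : (val x).2 = (val y).2 -> x != y ->
    forall z,
      psi (bar_cost c) (bar_split x) z = phi (bar_cost c) (bar_split x) z.
  move=> xy neq_xy z; have game_x := game_cc_bar_split gameB xy neq_xy.
  have disj_x := @disjoint_bar_split _ _ _ x.
  apply: IHn => //.
  have le_card := card_bar_player disjB.
  (* This gives [m < #|N|], so that the truncated difference [#|N| - m] really drops when a block is
     added. *)
  have lt_m := leq_trans (disjoint_blocks_leq game_x.2.1 disj_x) le_card.
  by rewrite (leq_ltn_trans (leq_sub2r _ le_card)) // subnSK.
have [q iBq] : exists q, i \in B q.
  have : i \in \bigcup_q B q by case: gameB => _ [_ ->]; rewrite inE.
  by case/bigcupP=> q _; exists q.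
(* BC-CC expresses differences within [B q] by split configurations, where the rules agree by
   induction. *)
have diff_const j : j \in B q -> psi c B j - phi c B j = psi c B i - phi c B i.
  move=> jBq; have [->//|neq_ij] := eqVneq i j.
  have Bij : blocks_of B i = blocks_of B j.
    apply/setP=> r; rewrite !inE.
    by apply/idP/idP => [/(disjB i q r iBq)|/(disjB j q r jBq)] <-.
  suff : psi c B i - psi c B j = phi c B i - phi c B j by move=> ?; lra.
  rewrite (psiB gameB Bij) (phiB gameB Bij); apply: eq_bigr => r _ /=.
  have neq_rep : rep (valP r) != rep (mem_blocks_of_eq Bij (valP r)).
    by apply: contraNneq neq_ij => /(congr1 val) [->].
  congr (_ - _).
    by apply: (agree_split _ (rep (valP r))) => //; rewrite eq_sym.
  exact: (agree_split _ _ _ neq_rep).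
have sumE :
    \sum_(j : {j : N | j \in B q}) (psi c B (val j) - phi c B (val j)) = 0.
  rewrite sumrB; apply/eqP; rewrite subr_eq0.
  under eq_bigr => j _ do rewrite (ADD_R_disjoint (valP j) psiA gameB disjB).
  under [X in _ == X]eq_bigr => j _ do
    rewrite (ADD_R_disjoint (valP j) phiA gameB disjB).
  by rewrite psiQ // phiQ // rules_agree_quotient.
apply/eqP; rewrite -subr_eq0.
move: sumE; rewrite (eq_bigr (fun=> psi c B i - phi c B i)) => [|j _]; last first.
  by rewrite diff_const // (valP j).
(* The constant gap times the number of players of [B q] is zero, and [B q] contains [i]. *)
rewrite sumr_const => /eqP; rewrite mulrn_eq0 => /orP[|//].
by rewrite -leqn0 leqNgt => /negP[]; apply/card_gt0P; exists (exist _ i iBq).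
Qed.

(** ADD-R passes to representatives, whose blocks are disjoint even when those of [B] overlap. *)
Lemma rules_agree (N : finType) (c : {set N} -> R) (m : nat)
    (B : 'I_m -> {set N}) (i : N) :
  game_cc c B -> psi c B i = phi c B i.
Proof.
move=> gameB; rewrite psiA // phiA //; apply: eq_bigr => q _.
apply: rules_agree_disjoint; first exact: game_cc_bar.
exact: disjoint_bar_block.
Qed.

End Uniqueness.
End Characterization.

Theorem theorem3p4 (R : realType) :
  [/\ configurational_shapley (@CV_rule R), ADD_R (@CV_rule R),
      BC_CC (@CV_rule R) & CQ (@CV_rule R)]
  /\ (forall psi : allocation_rule R,
        configurational_shapley psi -> ADD_R psi -> BC_CC psi -> CQ psi ->
        forall (N : finType) (c : {set N} -> R) (m : nat)
               (B : 'I_m -> {set N}),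
          game_cc c B -> forall i : N, psi N c m B i = CV c B i).
Proof.
split; first by split; [exact: CV_configurational_shapley | exact: CV_ADD_R
                       | exact: CV_BC_CC | exact: CV_CQ].
move=> psi psiS psiA psiB psiQ N c m B gameB i.
apply: (rules_agree psiS psiA psiB psiQ (phi := @CV_rule R)) => //.
- exact: CV_configurational_shapley.
- exact: CV_ADD_R.
- exact: CV_BC_CC.
- exact: CV_CQ.
Qed.
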